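(* Assume $\cos\theta_\alpha-\cos\theta_\beta\cos\theta_\gamma<0$. Let $n=n_1n_2n_3$ and let $K_3\in\mathbb{C}^{n\times n}$ be the matrix $$K_3=\frac1{\delta_z}\begin{bmatrix}-I_{n_1n_2}&I_{n_1n_2}&&&\\&-I_{n_1n_2}&I_{n_1n_2}&&\\&&\ddots&\ddots&\\&&&-I_{n_1n_2}&I_{n_1n_2}\\ e^{\imath2\pi\mathbf{k}\cdot\mathbf{a}_3}J_3&&&&-I_{n_1n_2}\end{bmatrix},$$ with $J_3$ as defined in the context. The eigenpairs of $K_3$ can be written as $$\big(\delta_z^{-1}(e^{\theta_{i,j,k}}-1),\ \mathbf{z}_{i,j,k}\otimes\mathbf{y}_{i,j}\otimes\mathbf{x}_i\big),\qquad i=1,\dots,n_1,\ j=1,\dots,n_2,\ k=1,\dots,n_3$$ (that is, these numbers are the eigenvalues of $K_3$, counted with multiplicity, with the indicated corresponding eigenvectors), where $$\theta_{i,j,k}=\frac{\imath2\pi\left(k-\frac{m_3}{n_2}j-\frac{n_2-m_3}{n_2}\frac{m_1}{n_1}i-\frac{m_2}{n_1}i+\mathbf{k}\cdot\hat{\mathbf{a}}_3\right)}{n_3},\qquad\mathbf{z}_{i,j,k}=\begin{bmatrix}1&e^{\theta_{i,j,k}}&\cdots&e^{(n_3-1)\theta_{i,j,k}}\end{bmatrix}^\top,$$ with $$\hat{\mathbf{a}}_3=\mathbf{a}_3-\frac{m_3}{n_2}\mathbf{a}_2-\frac{n_2-m_3}{n_2}\frac{m_1}{n_1}\mathbf{a}_1-\frac{m_2}{n_1}\mathbf{a}_1+\rho_3\mathbf{a}_2-\frac{m_3}{n_2}\rho_1\mathbf{a}_1+\rho_1\mathbf{a}_1+\rho_2\mathbf{a}_1,$$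 and $\mathbf{x}_i=[1\ e^{\theta_i}\ \cdots\ e^{(n_1-1)\theta_i}]^\top$, $\theta_i=\frac{\imath2\pi(i+\mathbf{k}\cdot\mathbf{a}_1)}{n_1}$; $\mathbf{y}_{i,j}=[1\ e^{\theta_{i,j}}\ \cdots\ e^{(n_2-1)\theta_{i,j}}]^\top$, $\theta_{i,j}=\frac{\imath2\pi(j-\frac{m_1}{n_1}i+\mathbf{k}\cdot\hat{\mathbf{a}}_2)}{n_2}$, $\hat{\mathbf{a}}_2=\mathbf{a}_2-\frac{m_1}{n_1}\mathbf{a}_1+\rho_1\mathbf{a}_1$.
   Context: $\imath=\sqrt{-1}$ (distinct from the integer index $i$); $\mathbf{k}\in\mathbb{R}^3$ ($2\pi\mathbf{k}$ is the Bloch wave vector; distinct from the integer index $k$). The lattice translation vectors $\mathbf{a}_1,\mathbf{a}_2,\mathbf{a}_3\in\mathbb{R}^3$ are linearly independent and of the form $\mathbf{a}_1=(\|\mathbf{a}_1\|,0,0)^\top$, $\mathbf{a}_2=(\|\mathbf{a}_2\|\cos\theta_\gamma,\ \|\mathbf{a}_2\|\sin\theta_\gamma,\ 0)^\top$, $\mathbf{a}_3=(\|\mathbf{a}_3\|\cos\theta_\beta,\ \|\mathbf{a}_3\|\frac{\cos\theta_\alpha-\cos\theta_\gamma\cos\theta_\beta}{\sin\theta_\gamma},\ l_3)^\top$ with angles $\theta_\alpha,\theta_\beta,\theta_\gamma\in(0,\pi)$, $l_3=\|\mathbf{a}_3\|\frac{\sqrt{1-\cos^2\theta_\gamma-\cos^2\theta_\beta-\cos^2\theta_\alpha+2\cos\theta_\gamma\cos\theta_\beta\cos\theta_\alpha}}{\sin\theta_\gamma}>0$,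 and $\|\mathbf{a}_1\|\ge\|\mathbf{a}_2\|,\|\mathbf{a}_3\|$. Put $l_1=\|\mathbf{a}_1\|$, $l_2=\|\mathbf{a}_2\|\sin\theta_\gamma$; $n_1,n_2,n_3$ are positive integers and $\delta_x=l_1/n_1$, $\delta_y=l_2/n_2$, $\delta_z=l_3/n_3$. The lattice is adapted to the grid: there are integers $0\le m_1,m_2\le n_1$ and $0\le m_3\le n_2$ with - $m_1=\frac{\|\mathbf{a}_2\|\cos\theta_\gamma}{\delta_x}$ if $\cos\theta_\gamma\ge0$, and $m_1=\frac{\|\mathbf{a}_1\|+\|\mathbf{a}_2\|\cos\theta_\gamma}{\delta_x}$ if $\cos\theta_\gamma<0$; - $m_2=\frac{\|\mathbf{a}_3\|\cos\theta_\beta}{\delta_x}$ if $\cos\theta_\beta\ge0$, and $m_2=\frac{\|\mathbf{a}_1\|+\|\mathbf{a}_3\|\cos\theta_\beta}{\delta_x}$ if $\cos\theta_\beta<0$; - $m_3=\frac{\|\mathbf{a}_2\|\sin^2\theta_\gamma+\|\mathbf{a}_3\|(\cos\theta_\alpha-\cos\theta_\gamma\cos\theta_\beta)}{\delta_y\sin\theta_\gamma}$ (in the case $\cos\theta_\alpha-\cos\theta_\gamma\cos\theta_\beta<0$ considered here). Constants: $\rho_1=\lceil\frac{2\theta_\gamma}{\pi}-1\rceil$, $\rho_2=\lceil\frac{2\theta_\beta}{\pi}-1\rceil$, $\rho_3=\lceil\cos\theta_\gamma\cos\theta_\beta-\cos\theta_\alpha\rceil$ (which equals $1$ here), $\rho_4=\lceil\cos\theta_\gamma\cos\theta_\beta(\cos\theta_\gamma\cos\theta_\beta-\cos\theta_\alpha)\rceil$,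 $\rho_5=\lceil\cos\theta_\beta\rceil$; $\psi_2=1$ if $(\rho_1n_1-m_1)+(\rho_2n_1-m_2)>0$, or if $m_1+m_2=n_1$ and $\rho_1+\rho_2=1$; $\psi_2=0$ otherwise. Let $J_1=e^{\imath2\pi\rho_2\mathbf{k}\cdot\mathbf{a}_1}\begin{bmatrix}0&e^{-\imath2\pi\mathbf{k}\cdot\mathbf{a}_1}I_{m_2}\\ I_{n_1-m_2}&0\end{bmatrix}$, and for an integer $0\le m\le n_1$ let $S_m=\begin{bmatrix}0&e^{-\imath2\pi\mathbf{k}\cdot\mathbf{a}_1}I_{m}\\ I_{n_1-m}&0\end{bmatrix}\in\mathbb{C}^{n_1\times n_1}$. The matrix $J_3\in\mathbb{C}^{n_1n_2\times n_1n_2}$ is: (3) if $m_1+m_2\le n_1$: $J_3=e^{\imath2\pi\rho_3\mathbf{k}\cdot\mathbf{a}_2}\begin{bmatrix}0&e^{-\imath2\pi\mathbf{k}\cdot\mathbf{a}_2}I_{m_3}\otimes J_1\\ e^{\imath2\pi(\rho_1\rho_4+\psi_2)\mathbf{k}\cdot\mathbf{a}_1}I_{n_2-m_3}\otimes S_{m_1+m_2}&0\end{bmatrix}$; (4) if $m_1+m_2>n_1$: $J_3=e^{\imath2\pi\rho_3\mathbf{k}\cdot\mathbf{a}_2}\begin{bmatrix}0&e^{-\imath2\pi\mathbf{k}\cdot\mathbf{a}_2}I_{m_3}\otimes J_1\\ e^{-\imath2\pi(\rho_5\rho_4-\psi_2)\mathbf{k}\cdot\mathbf{a}_1}I_{n_2-m_3}\otimes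 S_{m_1+m_2-n_1}&0\end{bmatrix}$. $\otimes$ is the Kronecker product, $I_m$ the identity of order $m$. Equivalently, on block vectors $v=(v_1,\dots,v_{n_3})$ with $v_s\in\mathbb{C}^{n_1n_2}$, $(K_3v)_s=\delta_z^{-1}(v_{s+1}-v_s)$ with $v_{n_3+1}:=e^{\imath2\pi\mathbf{k}\cdot\mathbf{a}_3}J_3v_1$. *)

(* Defs.v *)
From HB Require Import structures.
From mathcomp Require Import all_boot all_order all_algebra.
From mathcomp Require Import complex mxtens.
From mathcomp Require Import reals sequences exp trigo.

Set Implicit Arguments.
Unset Strict Implicit.
Unset Printing Implicit Defensive.

Import Order.TTheory GRing.Theory Num.Theory.

Local Open Scope ring_scope.
Local Open Scope complex_scope.

Definition cexp (R : realType) (z : R[i]) : R[i] :=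
  (expR (complex.Re z))%:C *
  (cos (complex.Im z) +i* sin (complex.Im z)).

Definition i2pi (R : realType) (x : R) : R[i] := 0 +i* (2 * pi * x).

Definition dot (R : realType) (u v : 'cV[R]_3) : R := \sum_(t < 3) u t 0 * v t 0.

(* The Euclidean norm; the library norm on matrices is the sup norm. *)
Definition enorm (R : realType) (v : 'cV[R]_3) : R := Num.sqrt (dot v v).

Definition vec3 (R : realType) (x y z : R) : 'cV[R]_3 :=
  \col_(t < 3) [:: x; y; z]`_t.

(* [ 0 A ; B 0 ] with A of order p and B of order q, as a matrix of order n.
   It is only used when p + q = n; conform_mx transports along that equation
   and yields the default 0 if it fails. *)
Definition antidiag_mx (T : pzRingType) (n p q : nat)
    (A : 'M[T]_p) (B : 'M[T]_q) : 'M[T]_n :=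
  conform_mx (0 : 'M[T]_n) (block_mx (0 : 'M[T]_(p, q)) A B (0 : 'M[T]_(q, p))).

(* The matrix made of p x p blocks B s t, all of order q. *)
Definition blocks_mx (T : Type) (p q : nat)
    (B : 'I_p -> 'I_p -> 'M[T]_q) : 'M[T]_(p * q) :=
  \matrix_(r, c) B (mxtens_unindex r).1 (mxtens_unindex c).1
                   (mxtens_unindex r).2 (mxtens_unindex c).2.

Definition power_vec (R : realType) (n : nat) (theta : R[i]) : 'cV[R[i]]_n :=
  \col_(t < n) cexp (t%:R * theta).

(* 2 pi kv is the Bloch wave vector; alpha, beta, gamma are the angles
   theta_alpha, theta_beta, theta_gamma. *)
Record lattice_data (R : realType) := LatticeData {
  kv : 'cV[R]_3;
  a1 : 'cV[R]_3;
  a2 : 'cV[R]_3;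
  a3 : 'cV[R]_3;
  alpha : R;
  beta : R;
  gamma : R;
  n1 : nat;
  n2 : nat;
  n3 : nat;
  m1 : nat;
  m2 : nat;
  m3 : nat
}.

Definition l1 (R : realType) (L : lattice_data R) : R := enorm (a1 L).

Definition l2 (R : realType) (L : lattice_data R) : R :=
  enorm (a2 L) * sin (gamma L).

Definition l3 (R : realType) (L : lattice_data R) : R :=
  enorm (a3 L) *
  (Num.sqrt (1 - cos (gamma L) ^+ 2 - cos (beta L) ^+ 2 - cos (alpha L) ^+ 2
             + 2 * cos (gamma L) * cos (beta L) * cos (alpha L))
   / sin (gamma L)).

Definition delta_x (R : realType) (L : lattice_data R) : R := l1 L / (n1 L)%:R.
Definition delta_y (R : realType) (L : lattice_data R) : R := l2 L / (n2 L)%:R.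
Definition delta_z (R : realType) (L : lattice_data R) : R := l3 L / (n3 L)%:R.

Record lattice_axioms (R : realType) (L : lattice_data R) : Prop := {
  alpha_range : 0 < alpha L < pi;
  beta_range : 0 < beta L < pi;
  gamma_range : 0 < gamma L < pi;
  a_free : free [:: a1 L; a2 L; a3 L];
  a1_form : a1 L = vec3 (enorm (a1 L)) 0 0;
  a2_form : a2 L = vec3 (enorm (a2 L) * cos (gamma L))
                        (enorm (a2 L) * sin (gamma L)) 0;
  a3_form : a3 L = vec3 (enorm (a3 L) * cos (beta L))
    (enorm (a3 L) *
       ((cos (alpha L) - cos (gamma L) * cos (beta L)) / sin (gamma L)))
    (l3 L);
  l3_gt0 : 0 < l3 L;
  a2_le_a1 : enorm (a2 L) <= enorm (a1 L);
  a3_le_a1 : enorm (a3 L) <= enorm (a1 L);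
  n1_gt0 : (0 < n1 L)%N;
  n2_gt0 : (0 < n2 L)%N;
  n3_gt0 : (0 < n3 L)%N
}.

Record grid_adapted (R : realType) (L : lattice_data R) : Prop := {
  m1_le : (m1 L <= n1 L)%N;
  m2_le : (m2 L <= n1 L)%N;
  m3_le : (m3 L <= n2 L)%N;
  m1_ge0E : 0 <= cos (gamma L) ->
    (m1 L)%:R = enorm (a2 L) * cos (gamma L) / delta_x L;
  m1_lt0E : cos (gamma L) < 0 ->
    (m1 L)%:R = (enorm (a1 L) + enorm (a2 L) * cos (gamma L)) / delta_x L;
  m2_ge0E : 0 <= cos (beta L) ->
    (m2 L)%:R = enorm (a3 L) * cos (beta L) / delta_x L;
  m2_lt0E : cos (beta L) < 0 ->
    (m2 L)%:R = (enorm (a1 L) + enorm (a3 L) * cos (beta L)) / delta_x L;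
  m3_lt0E : cos (alpha L) - cos (gamma L) * cos (beta L) < 0 ->
    (m3 L)%:R =
      (enorm (a2 L) * sin (gamma L) ^+ 2
       + enorm (a3 L) * (cos (alpha L) - cos (gamma L) * cos (beta L)))
      / (delta_y L * sin (gamma L))
}.

Definition rho1 (R : realType) (L : lattice_data R) : int :=
  Num.ceil (2 * gamma L / pi - 1).

Definition rho2 (R : realType) (L : lattice_data R) : int :=
  Num.ceil (2 * beta L / pi - 1).

Definition rho3 (R : realType) (L : lattice_data R) : int :=
  Num.ceil (cos (gamma L) * cos (beta L) - cos (alpha L)).

Definition rho4 (R : realType) (L : lattice_data R) : int :=
  Num.ceil (cos (gamma L) * cos (beta L)
            * (cos (gamma L) * cos (beta L) - cos (alpha L))).

Definition rho5 (R : realType) (L : lattice_data R) : int :=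
  Num.ceil (cos (beta L)).

Definition psi2 (R : realType) (L : lattice_data R) : int :=
  if (0 < (rho1 L * (n1 L)%:Z - (m1 L)%:Z) + (rho2 L * (n1 L)%:Z - (m2 L)%:Z))
     || ((m1 L + m2 L == n1 L)%N && (rho1 L + rho2 L == 1))
  then 1 else 0.

Definition ka1 (R : realType) (L : lattice_data R) : R := dot (kv L) (a1 L).
Definition ka2 (R : realType) (L : lattice_data R) : R := dot (kv L) (a2 L).
Definition ka3 (R : realType) (L : lattice_data R) : R := dot (kv L) (a3 L).

Definition shift_mx (R : realType) (L : lattice_data R) (m : nat) :
    'M[R[i]]_(n1 L) :=
  antidiag_mx (n1 L)
    (cexp (i2pi (- ka1 L)) *: (1%:M : 'M[R[i]]_m))
    (1%:M : 'M[R[i]]_(n1 L - m)).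

Definition J1 (R : realType) (L : lattice_data R) : 'M[R[i]]_(n1 L) :=
  cexp (i2pi ((rho2 L)%:~R * ka1 L)) *: shift_mx L (m2 L).

Definition J3_block (R : realType) (L : lattice_data R)
    (c : R) (S : 'M[R[i]]_(n1 L)) : 'M[R[i]]_(n2 L * n1 L) :=
  cexp (i2pi ((rho3 L)%:~R * ka2 L)) *:
  antidiag_mx (n2 L * n1 L)
    (cexp (i2pi (- ka2 L)) *: ((1%:M : 'M[R[i]]_(m3 L)) *t J1 L))
    (cexp (i2pi c) *: ((1%:M : 'M[R[i]]_(n2 L - m3 L)) *t S)).

Definition J3 (R : realType) (L : lattice_data R) : 'M[R[i]]_(n2 L * n1 L) :=
  if (m1 L + m2 L <= n1 L)%N then
    J3_block ((rho1 L * rho4 L + psi2 L)%:~R * ka1 L)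
             (shift_mx L (m1 L + m2 L))
  else
    J3_block (- ((rho5 L * rho4 L - psi2 L)%:~R * ka1 L))
             (shift_mx L (m1 L + m2 L - n1 L)).

(* The contributions are summed so that, when n3 = 1, the corner block adds to
   the single diagonal block. *)
Definition K3 (R : realType) (L : lattice_data R) :
    'M[R[i]]_(n3 L * (n2 L * n1 L)) :=
  ((delta_z L)^-1)%:C *: blocks_mx (fun s t : 'I_(n3 L) =>
    (if t == s then - 1%:M else 0)
    + (if t == s.+1 :> nat then 1%:M else 0)
    + (if (s.+1 == n3 L) && (t == 0 :> nat)
       then cexp (i2pi (ka3 L)) *: J3 L else 0)).

Definition hat_a2 (R : realType) (L : lattice_data R) : 'cV[R]_3 :=
  a2 L - ((m1 L)%:R / (n1 L)%:R) *: a1 L + (rho1 L)%:~R *: a1 L.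

Definition hat_a3 (R : realType) (L : lattice_data R) : 'cV[R]_3 :=
  a3 L - ((m3 L)%:R / (n2 L)%:R) *: a2 L
  - (((n2 L)%:R - (m3 L)%:R) / (n2 L)%:R * ((m1 L)%:R / (n1 L)%:R)) *: a1 L
  - ((m2 L)%:R / (n1 L)%:R) *: a1 L
  + (rho3 L)%:~R *: a2 L
  - ((m3 L)%:R / (n2 L)%:R * (rho1 L)%:~R) *: a1 L
  + (rho1 L)%:~R *: a1 L + (rho2 L)%:~R *: a1 L.

Definition theta_i (R : realType) (L : lattice_data R) (i : nat) : R[i] :=
  i2pi (i%:R + ka1 L) / (n1 L)%:R.

Definition theta_ij (R : realType) (L : lattice_data R) (i j : nat) : R[i] :=
  i2pi (j%:R - (m1 L)%:R / (n1 L)%:R * i%:R + dot (kv L) (hat_a2 L))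
  / (n2 L)%:R.

Definition theta_ijk (R : realType) (L : lattice_data R) (i j k : nat) : R[i] :=
  i2pi (k%:R - (m3 L)%:R / (n2 L)%:R * j%:R
        - ((n2 L)%:R - (m3 L)%:R) / (n2 L)%:R * ((m1 L)%:R / (n1 L)%:R) * i%:R
        - (m2 L)%:R / (n1 L)%:R * i%:R
        + dot (kv L) (hat_a3 L))
  / (n3 L)%:R.

Definition xvec (R : realType) (L : lattice_data R) (i : nat) :=
  power_vec (n1 L) (theta_i L i).

Definition yvec (R : realType) (L : lattice_data R) (i j : nat) :=
  power_vec (n2 L) (theta_ij L i j).

Definition zvec (R : realType) (L : lattice_data R) (i j k : nat) :=
  power_vec (n3 L) (theta_ijk L i j k).

Definition K3_eigval (R : realType) (L : lattice_data R) (i j k : nat) : R[i] :=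
  ((delta_z L)^-1)%:C * (cexp (theta_ijk L i j k) - 1).

Definition K3_eigvec (R : realType) (L : lattice_data R) (i j k : nat) :
    'cV[R[i]]_(n3 L * (n2 L * n1 L)) :=
  zvec L i j k *t (yvec L i j *t xvec L i).

(* Main.v *)
Require Import Defs.
From HB Require Import structures.
From mathcomp Require Import all_boot all_order all_algebra.
From mathcomp Require Import complex mxtens.
From mathcomp Require Import reals sequences exp trigo.
From mathcomp Require Import ring lra zify.

(** The matrix K_3 is a forward difference along a_3 closed up by J_3, J_3 is
    a shift of the rows of the grid closed up by J_1 and S_m, and these are
    shifts of one row of the grid closed up by a phase.  A cyclic shift by m
    places of vectors of length n which multiplies what wraps around by
    omega^-1 acts on the geometric vector (1, w, w^2, ...) as w^-m when
    w^n = omega.  At each of the three levels this principle gives as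
    many distinct ratios w, the roots of w^n = omega, as there are places.

    On one row, every S_m acts on x_i as w^-m, where w = e^(theta_i).  On a
    layer, J_3 wraps around by applying a different operator from the one it
    applies without wrapping (J_1 against a multiple of some S_m).  Both are
    scalars on x_i, so y_ij (x) x_i, with u = e^(theta_ij), is an eigenvector
    of J_3 as soon as u^n2 is e^(2 i pi k.a_2) times the second scalar divided
    by the first ([J3_block_geom]).  This holds for the given theta_ij
    provided that the integers rho_4, rho_5 and psi_2 in the definition of J_3
    supply the phase e^(2 i pi (rho_1 + rho_2) k.a_1), divided by
    e^(2 i pi k.a_1) when m_1 + m_2 exceeds n_1.  This is [phase_balance], where
    the geometry of the lattice enters: it is checked by cases on the signs of
    cos theta_gamma and cos theta_beta.  On the whole grid, K_3 acts on z (x) v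
    for an eigenvector v of J_3 as a difference operator, whose eigenvectors
    are again geometric ([K3_eigen]).

    The eigenvectors are free because w_i is injective in i, u_ij in j for
    fixed i, and z_ijk in k for fixed i, j: three successive Vandermonde
    arguments kill the coefficients of a linear relation ([nested_geom_free]).
    There are as many of them as the order of K_3, hence they diagonalize it
    and the characteristic polynomial splits as claimed
    ([char_poly_eigenbasis]). *)

Import Order.TTheory GRing.Theory Num.Theory.

Local Open Scope ring_scope.
Local Open Scope complex_scope.

Set Implicit Arguments.
Unset Strict Implicit.

(** * Geometric sequences with distinct ratios and eigenbases *)

(** The hypothesis says that a Vandermonde matrix with distinct nodes
    kills [c]. *)
Lemma sum_geom_eq0 (F : fieldType) (n : nat) (w c : 'I_n -> F) :
    injective w -> (forall s : 'I_n, \sum_i c i * w i ^+ s = 0) ->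
  forall i, c i = 0.
Proof.
move=> w_inj c0 i.
pose V := Vandermonde n (\row_j w j).
have V_unit : V \in unitmx.
  rewrite unitmxE unitfE det_Vandermonde.
  apply/prodf_neq0 => a _; apply/prodf_neq0 => b ltab.
  rewrite !mxE subr_eq0; apply: contraTneq ltab => /w_inj ->.
  by rewrite ltnn.
have Vc : V *m \col_j c j = 0.
  apply/matrixP => s k; rewrite !mxE -[RHS](c0 s); apply: eq_bigr => j _.
  by rewrite !mxE mulrC.
have /matrixP/(_ i 0) : \col_j c j = 0.
  by rewrite -(mulKmx V_unit (\col_j c j)) Vc mulmx0.
by rewrite !mxE.
Qed.

(** Independence of a family indexed by a finite type, without the
    enumeration of that type. *)
Lemma free_imageP (F : fieldType) (V : vectType F) (T : finType) (f : T -> V) :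
  reflect (forall c : T -> F, \sum_t c t *: f t = 0 -> forall t, c t = 0)
          (free [seq f t | t : T]).
Proof.
pose X : #|T|.-tuple V := [tuple of codom f].
have sumE (k : 'I_#|T| -> F) :
    \sum_i k i *: X`_i = \sum_t k (enum_rank t) *: f t.
  rewrite (reindex (@enum_rank T)) /=; last exact/onW_bij/enum_rank_bij.
  by apply: eq_bigr => t _; rewrite nth_codom enum_rankK.
have -> : [seq f t | t : T] = X by [].
apply: (iffP freeP) => [freeX c c0 t | freef k]; last first.
  rewrite sumE => /freef k0 i; rewrite -(enum_valK i); exact: k0.
have := freeX (c \o enum_val); rewrite sumE /=.
rewrite (eq_bigr (fun t => c t *: f t)) => [/(_ c0 (enum_rank t))|s _];
  by rewrite enum_rankK.
Qed.

(** The invertible matrix [P] of the eigenvectors satisfies [A P = P D] with [D]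
    diagonal; multiplicativity of the determinant then identifies the two
    characteristic polynomials. *)
Lemma char_poly_eigenbasis (F : fieldType) (n : nat) (T : finType)
    (A : 'M[F]_n) (f : T -> 'cV[F]_n) (d : T -> F) :
    #|T| = n -> (forall t, A *m f t = d t *: f t) ->
    free [seq f t | t : T] ->
  char_poly A = \prod_(t : T) ('X - (d t)%:P).
Proof.
move=> cardT; case: n / cardT A f => A f Af /free_imageP freef.
pose P := \matrix_(r, c) f (enum_val c) r 0 : 'M[F]_#|T|.
pose D := diag_mx (\row_c d (enum_val c)) : 'M[F]_#|T|.
have P_unit : P \in unitmx.
  rewrite -unitmx_tr -row_free_unit; apply: inj_row_free => v vP0.
  apply/rowP => c; rewrite mxE -(enum_valK c).
  apply: (freef (fun t => v 0 (enum_rank t))).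
  move/matrixP: vP0 => vP0; apply/matrixP => r z; rewrite ord1.
  have vPr := vP0 0 r; rewrite !mxE in vPr; rewrite summxE mxE -[RHS]vPr.
  rewrite [RHS](reindex (@enum_rank T)) /=; last exact/onW_bij/enum_rank_bij.
  by apply: eq_bigr => t _; rewrite !mxE enum_rankK.
have AP : A *m P = P *m D.
  apply/matrixP => r c; have /matrixP/(_ r 0) := Af (enum_val c).
  rewrite mul_mx_diag !mxE mulrC => <-.
  by apply: eq_bigr => s _; rewrite !mxE.
have charAP : char_poly_mx A *m map_mx polyC P
            = map_mx polyC P *m char_poly_mx D.
  rewrite /char_poly_mx mulmxBl mulmxBr -!map_mxM AP.
  by rewrite mul_scalar_mx mul_mx_scalar.
have detP : \det (map_mx polyC P) != 0.
  by rewrite det_map_mx polyC_eq0 -unitfE -unitmxE.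
have <- : char_poly D = \prod_t ('X - (d t)%:P).
  rewrite char_poly_trig; last exact/is_diag_mx_is_trig/diag_mx_is_diag.
  rewrite [RHS](reindex (@enum_val T T)) /=; last exact/onW_bij/enum_val_bij.
  by apply: eq_bigr => c _; rewrite !mxE eqxx.
by apply: (mulIf detP); rewrite /char_poly -det_mulmx charAP det_mulmx mulrC.
Qed.

Lemma big_triple (V : Type) (idx : V) (op : Monoid.com_law idx)
    (I J K : finType) (F : I * J * K -> V) :
  \big[op/idx]_t F t = \big[op/idx]_i \big[op/idx]_j \big[op/idx]_k F (i, j, k).
Proof. by rewrite !pair_bigA; apply: eq_bigr => -[[i j] k] _. Qed.

Definition geom (T : pzRingType) (n : nat) (w : T) : 'cV[T]_n :=
  \col_(t < n) w ^+ t.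

(** The ratio of the middle factor depends on [i] and that of the outer factor
    on [i] and [j], so that the sum over triples is not a product of three sums.
    The indices are separated from the inside out: first [i] by the [w i], then
    [j] by the [u i j] with [i] fixed, then [k] by the [z i j k] with [i] and
    [j] fixed. *)
Lemma nested_geom_free (F : fieldType) (n p q : nat) (w : 'I_n -> F)
    (u : 'I_n -> 'I_p -> F) (z : 'I_n -> 'I_p -> 'I_q -> F) :
    injective w -> (forall i, injective (u i)) ->
    (forall i j, injective (z i j)) ->
  free [seq (geom q (z t.1.1 t.1.2 t.2)
              *t (geom p (u t.1.1 t.1.2) *t geom n (w t.1.1))
               : 'cV[F]_(q * (p * n))) | t : 'I_n * 'I_p * 'I_q].
Proof.
move=> w_inj u_inj z_inj; apply/free_imageP => c c0.
have c0E (r : 'I_q) (s : 'I_p) (a : 'I_n) :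
    \sum_i (\sum_j (\sum_k c (i, j, k) * z i j k ^+ r) * u i j ^+ s)
      * w i ^+ a = 0.
  have /matrixP/(_ (mxtens_index (r, mxtens_index (s, a))) 0) := c0.
  rewrite summxE mxE big_triple => e; rewrite -[RHS]e.
  apply: eq_bigr => i _; rewrite mulr_suml; apply: eq_bigr => j _.
  rewrite !mulr_suml; apply: eq_bigr => k _.
  by rewrite !mxE !mxtens_indexK /= !mulrA.
have c1 r s := sum_geom_eq0 w_inj (c0E r s).
have c2 r i := sum_geom_eq0 (u_inj i) (fun s => c1 r s i).
move=> [[i j] k]; exact: sum_geom_eq0 (z_inj i j) (fun r => c2 r i j) k.
Qed.

(** * Unit complex numbers as phases *)

Definition phase (R : realType) (x : R) : R[i] := cexp (i2pi x).

Lemma cexpD (R : realType) (z w : R[i]) : cexp (z + w) = cexp z * cexp w.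
Proof.
case: z w => [a b] [c d]; rewrite /cexp /= expRD cosD sinD.
by apply/eqP; rewrite eq_complex /=; apply/andP; split; apply/eqP; ring.
Qed.

Lemma cexp0 (R : realType) : cexp (0 : R[i]) = 1.
Proof. by rewrite /cexp /= expR0 cos0 sin0 mul1r. Qed.

Lemma cexp_natmul (R : realType) (n : nat) (z : R[i]) :
  cexp (n%:R * z) = cexp z ^+ n.
Proof.
elim: n => [|n IHn]; first by rewrite mul0r cexp0 expr0.
by rewrite -natr1 mulrDl mul1r cexpD IHn exprSr.
Qed.

Lemma power_vecE (R : realType) (n : nat) (theta : R[i]) :
  power_vec n theta = geom n (cexp theta).
Proof. by apply/colP => t; rewrite !mxE cexp_natmul. Qed.

Lemma i2piE (R : realType) (x : R) : i2pi x = x%:C * i2pi 1.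
Proof.
by apply/eqP; rewrite eq_complex /=; apply/andP; split; apply/eqP; ring.
Qed.

Lemma phaseD (R : realType) (x y : R) : phase (x + y) = phase x * phase y.
Proof. by rewrite /phase -cexpD i2piE rmorphD mulrDl -!i2piE. Qed.

Lemma phase0 (R : realType) : phase (0 : R) = 1.
Proof. by rewrite /phase i2piE mul0r cexp0. Qed.

Lemma phaseX (R : realType) (n : nat) (x : R) :
  phase x ^+ n = phase (n%:R * x).
Proof.
by rewrite /phase -cexp_natmul i2piE (i2piE (_ * _)) rmorphM rmorph_nat mulrA.
Qed.

Lemma phase_neq0 (R : realType) (x : R) : phase x != 0.
Proof.
apply/eqP => x0; have /eqP := phase0 R.
by rewrite -(subrr x) phaseD x0 mul0r eq_sym oner_eq0.
Qed.

Lemma phaseN (R : realType) (x : R) : phase (- x) = (phase x)^-1.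
Proof.
apply: (mulfI (phase_neq0 x)).
by rewrite -phaseD subrr phase0 divff ?phase_neq0.
Qed.

Lemma phase_nat (R : realType) (n : nat) : phase (n%:R : R) = 1.
Proof.
rewrite -[n%:R]mulr1 -phaseX /phase /cexp /i2pi /= expR0 mulr1 mulr_natl.
by rewrite cos2pi -[pi *+ 2]add0r sinD2pi sin0 mul1r expr1n.
Qed.

Lemma phase_natD (R : realType) (n : nat) (x : R) : phase (n%:R + x) = phase x.
Proof. by rewrite phaseD phase_nat mul1r. Qed.

Lemma phase_fracX (R : realType) (n : nat) (x : R) : (0 < n)%N ->
  phase (x / n%:R) ^+ n = phase x.
Proof.
by move=> n0; rewrite phaseX mulrCA divff ?mulr1 // pnatr_eq0 -lt0n.
Qed.

(** The real part of the phase is 1 - 2 sin(pi x)^2, with sin(pi x) > 0. *)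
Lemma phase_neq1 (R : realType) (x : R) : 0 < x < 1 -> phase x != 1.
Proof.
move=> /andP[x0 x1]; rewrite /phase /cexp /i2pi /= expR0 mul1r.
have sx : 0 < sin (pi * x).
  apply: sin_gt0_pi; rewrite mulr_gt0 ?pi_gt0 //=.
  by rewrite gtr_pMr ?pi_gt0.
apply/eqP => /(congr1 (@complex.Re R)) /=.
have -> : 2 * pi * x = (pi * x) *+ 2 by ring.
rewrite cos_mulr2n cos2sin2 => e.
have : sin (pi * x) ^+ 2 = 0 by lra.
by move/eqP; rewrite expf_eq0 /= gt_eqF.
Qed.

Lemma cexp_i2pi_div (R : realType) (n : nat) (x : R) :
  cexp (i2pi x / n%:R) = phase (x / n%:R).
Proof.
by rewrite /phase i2piE (i2piE (_ / _)) rmorphM fmorphV rmorph_nat mulrAC.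
Qed.

(** The phases are the [n] distinct roots of w^n = e^(2 i pi a). *)
Lemma phase_frac_inj (R : realType) (n : nat) (a : R) :
  injective (fun i : 'I_n => phase ((i.+1%:R + a) / n%:R)).
Proof.
have lt_neq (i j : 'I_n) : (i < j)%N ->
    phase ((i.+1%:R + a) / n%:R) != phase ((j.+1%:R + a) / n%:R).
  move=> ltij; have n0 : (0 : R) < n%:R.
    by rewrite ltr0n (leq_ltn_trans _ (ltn_ord i)).
  have -> : (j.+1%:R + a) / n%:R
          = (i.+1%:R + a) / n%:R + (j - i)%N%:R / n%:R.
    by rewrite -mulrDl natrB ?(ltnW ltij) // -!natr1; congr (_ / _); ring.
  rewrite phaseD -[X in X != _]mulr1 eq_sym.
  rewrite (inj_eq (mulfI (phase_neq0 _))) phase_neq1 //.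
  apply/andP; split; first by rewrite divr_gt0 // ltr0n subn_gt0.
  rewrite ltr_pdivrMr // mul1r ltr_nat.
  exact: leq_ltn_trans (leq_subr _ _) (ltn_ord j).
move=> i j eij; apply: val_inj; apply/eqP.
by case: ltngtP => // /lt_neq; rewrite eij eqxx.
Qed.

(** * Block matrices acting on geometric vectors *)

(** Writing the vector with its entries as a function on nat avoids
    the transport along [p + q = n]: the vector splits as [q + p] entries on the
    input side and as [p + q] entries on the output side. *)
Lemma antidiag_mx_col (T : pzRingType) (n p q : nat) (A : 'M[T]_p) (B : 'M[T]_q)
    (f : nat -> T) (lam : T) : (p + q = n)%N ->
    A *m \col_(r < p) f (q + r)%N = lam *: \col_(r < p) f r ->
    B *m \col_(r < q) f r = lam *: \col_(r < q) f (p + r)%N ->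
  antidiag_mx n A B *m \col_(r < n) f r = lam *: \col_(r < n) f r.
Proof.
move=> <- Af Bf; rewrite /antidiag_mx.
rewrite -(conform_castmx (erefl (p + q)%N, addnC q p)) conform_mx_id.
have colE a b : \col_(r < a + b) f r
    = col_mx (\col_(r < a) f r) (\col_(r < b) f (a + r)%N).
  by apply/colP => r; rewrite !mxE; case: split_ordP => k ->; rewrite mxE.
have colcast : \col_(r < p + q) f r
        = castmx (addnC q p, erefl 1%N) (\col_(r < q + p) f r).
  by apply/matrixP => i j; rewrite castmxE !mxE.
have mul_castmx k (e : (q + p = k)%N) (M : 'M[T]_(p + q, q + p)) v :
    castmx (erefl (p + q)%N, e) M *m castmx (e, erefl 1%N) v = M *m v.
  by case: k / e; rewrite !castmx_id.
rewrite {1}colcast mul_castmx !colE mul_block_col !mul0mx add0r addr0 Af Bf.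
by rewrite scale_col_mx.
Qed.

Lemma geom_shift (T : comPzRingType) (n m : nat) (w : T) :
  \col_(t < n) w ^+ (m + t) = w ^+ m *: geom n w.
Proof. by apply/colP => t; rewrite !mxE exprD. Qed.

Lemma tens_geom (T : comPzRingType) (m d : nat) (u w : T) :
  geom m u *t geom d w = \col_(r < m * d) (u ^+ (r %/ d) * w ^+ (r %% d)).
Proof. by apply/matrixP => r c; rewrite !mxE. Qed.

Lemma tens_geom_shift (T : comPzRingType) (m d q : nat) (u w : T) :
    (0 < d)%N ->
  \col_(r < m * d) (u ^+ ((q * d + r) %/ d) * w ^+ ((q * d + r) %% d))
  = u ^+ q *: (geom m u *t geom d w).
Proof.
move=> d0; apply/matrixP => r c.
by rewrite tens_geom !mxE divnMDl // modnMDl exprD mulrA.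
Qed.

Lemma tensmxZr (T : comPzRingType) (m n p q : nat) (a : T)
    (A : 'M[T]_(m, n)) (B : 'M[T]_(p, q)) :
  A *t (a *: B) = a *: (A *t B).
Proof. by apply/matrixP => i j; rewrite !mxE mulrCA. Qed.

(** [tensmx_mul] for column vectors, typed with one column instead of [1 * 1],
    so that it can be used for rewriting. *)
Lemma tensmx_mul_col (T : comPzRingType) (m d : nat) (A : 'M[T]_m)
    (B : 'M[T]_d) (u : 'cV[T]_m) (v : 'cV[T]_d) :
  (A *t B) *m (u *t v : 'cV_(m * d)) = (A *m u) *t (B *m v) :> 'cV_(m * d).
Proof. exact: (tensmx_mul A B u v). Qed.

(** A common eigenvector [v] of all blocks reduces the block matrix to the
    matrix of order [p] of their eigenvalues. *)
Lemma blocks_mx_mul_tens (T : comPzRingType) (p d : nat)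
    (B : 'I_p -> 'I_p -> 'M[T]_d) (b : 'I_p -> 'I_p -> T)
    (z : 'cV[T]_p) (v : 'cV[T]_d) :
    (forall s t, B s t *m v = b s t *: v) ->
  blocks_mx B *m (z *t v : 'cV_(p * d))
  = (\col_s \sum_t b s t * z t 0) *t v :> 'cV_(p * d).
Proof.
move=> Bv; apply/matrixP => r o; rewrite !mxE.
rewrite (reindex (@mxtens_index p d)) /=; last first.
  exists (@mxtens_unindex p d) => ? _.
    exact: mxtens_indexK.
  exact: mxtens_unindexK.
transitivity (\sum_t \sum_a blocks_mx B r (mxtens_index (t, a))
                             * (z *t v) (mxtens_index (t, a)) o).
  by rewrite pair_bigA; apply: eq_bigr => -[t a].
rewrite mulr_suml; apply: eq_bigr => t _.
have /matrixP/(_ (mxtens_unindex r).2 0) :=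
  Bv (mxtens_unindex r).1 t.
rewrite !mxE mulrAC !ord1 => <-; rewrite mulr_suml; apply: eq_bigr => a _.
by rewrite !mxE mxtens_indexK /= !ord1 mulrA mulrAC.
Qed.

(** In the last row, [zeta ^+ p] is the entry that would follow the last one
    of the geometric sequence, so this row behaves as all others. *)
Lemma twisted_difference_geom (T : comPzRingType) (p : nat) (zeta : T)
    (s : 'I_p) :
  \sum_(t < p) ((if t == s then - 1 else 0)
      + (if t == s.+1 :> nat then 1 else 0)
      + (if (s.+1 == p) && (t == 0 :> nat) then zeta ^+ p else 0)) * zeta ^+ t
  = (zeta - 1) * zeta ^+ s.
Proof.
have pick (a : nat) (g : T) :
   \sum_(t < p) (if t == a :> nat then g else 0) * zeta ^+ t
   = if (a < p)%N then g * zeta ^+ a else 0.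
  transitivity (\sum_(t < p | t == a :> nat) g * zeta ^+ t); last first.
    exact: (big_ord1_eq _ (fun t => g * zeta ^+ t)).
  rewrite [RHS]big_mkcond /=.
  by apply: eq_bigr => t _; case: eqP; rewrite ?mul0r.
rewrite (eq_bigr (fun t : 'I_p =>
  (if t == s :> nat then -1 else 0) * zeta ^+ t
  + (if t == s.+1 :> nat then 1 else 0) * zeta ^+ t
  + (if t == 0 :> nat then if s.+1 == p then zeta ^+ p else 0 else 0)
    * zeta ^+ t)); last first.
  by move=> t _; rewrite !mulrDl -val_eqE; congr (_ + _ + _ * _); do !case: eqP.
rewrite !big_split /= !pick ltn_ord (leq_ltn_trans (leq0n _) (ltn_ord s)).
move: (ltn_ord s); move: (nat_of_ord s) => {}s.
rewrite leq_eqVlt; case: eqP => [<- _|_ /= ->]; rewrite ?ltnn expr0 exprS; ring.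
Qed.

(** * The rounding constants *)

Lemma ceil_Ioc (R : realType) (x : R) : -1 < x <= 1 ->
  Num.ceil x = if 0 < x then 1 else 0.
Proof.
move=> /andP[x1 x2]; apply: ceil_def.
by case: (ltP 0 x) => x0; rewrite ?subrr ?sub0r ?rmorphN ?rmorph0 ?rmorph1
  ?x0 ?x1.
Qed.

(** The argument of the ceiling lies in ]-1, 1[, and it is positive exactly
    when [t] exceeds pi / 2, where the cosine becomes negative. *)
Lemma ceil_angle (R : realType) (t : R) : 0 < t < pi ->
  Num.ceil (2 * t / pi - 1) = if cos t < 0 then 1 else 0.
Proof.
move=> /andP[t0 tpi]; have pi0 := pi_gt0 R.
have dE : 2 * t / pi - 1 = (t - pi / 2) * (2 / pi) by field; lra.
have -> : (cos t < 0) = (0 < 2 * t / pi - 1).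
  rewrite dE pmulr_lgt0 ?divr_gt0 // subr_gt0.
  case: (ltgtP (pi / 2) t) => [tlt|tgt|<-]; last by rewrite cos_pihalf ltxx.
    rewrite -[t](subrK (pi / 2)) cosDpihalf oppr_lt0 sin_gt0_pihalf //.
    by apply/andP; split; lra.
  apply/negbTE; rewrite -leNgt; apply/ltW/cos_gt0_pihalf.
  by apply/andP; split; lra.
apply: ceil_Ioc; rewrite dE; apply/andP; split.
  rewrite -ltr_pdivrMr ?divr_gt0 // invf_div; lra.
rewrite -ler_pdivlMr ?divr_gt0 // invf_div; lra.
Qed.

Lemma cos_gtN1 (R : realType) (t : R) : 0 < t < pi -> -1 < cos t.
Proof.
move=> /sin_gt0_pi s0; have := cos2Dsin2 t; have := exprn_gt0 2 s0; nra.
Qed.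

Lemma vec3_eq0 (R : realType) : vec3 (0 : R) 0 0 = 0.
Proof. by apply/colP => -[[|[|[|t]]] lt3] //; rewrite /vec3 !mxE. Qed.

Lemma enorm_ge0 (R : realType) (v : 'cV[R]_3) : 0 <= enorm v.
Proof. exact: sqrtr_ge0. Qed.

Lemma norm_a1_gt0 (R : realType) (L : lattice_data R) (hL : lattice_axioms L) :
  0 < enorm (a1 L).
Proof.
rewrite lt_def enorm_ge0 andbT; apply/eqP => a0.
have := free_not0 (a_free hL) (mem_head _ _).
by rewrite (a1_form hL) a0 vec3_eq0 eqxx.
Qed.

Lemma norm_a2_gt0 (R : realType) (L : lattice_data R) (hL : lattice_axioms L) :
  0 < enorm (a2 L).
Proof.
rewrite lt_def enorm_ge0 andbT; apply/eqP => a0.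
have a2_in : a2 L \in [:: a1 L; a2 L; a3 L] by rewrite !inE eqxx orbT.
have := free_not0 (a_free hL) a2_in.
by rewrite (a2_form hL) a0 !mul0r vec3_eq0 eqxx.
Qed.

(** [a1] and [a2] do not vanish, being free, so that the quotient defining [m1]
    is [n1] plus a negative number. *)
Lemma m1_lt_n1 (R : realType) (L : lattice_data R)
    (hL : lattice_axioms L) (hgrid : grid_adapted L) :
  cos (gamma L) < 0 -> (m1 L < n1 L)%N.
Proof.
move=> c0; rewrite -(ltr_nat R) (m1_lt0E hgrid c0) /delta_x /l1.
have A1 := norm_a1_gt0 hL; have A2 := norm_a2_gt0 hL.
have N1 : (0 : R) < (n1 L)%:R by rewrite ltr0n (n1_gt0 hL).
rewrite invf_div mulrA ltr_pdivrMr // mulrC ltr_pM2l //.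
by rewrite gtrDl pmulr_rlt0.
Qed.

Lemma m1_eq0 (R : realType) (L : lattice_data R) (hgrid : grid_adapted L) :
  cos (gamma L) = 0 -> m1 L = 0%N.
Proof.
move=> c0; apply/eqP; rewrite -(pnatr_eq0 R) (m1_ge0E hgrid) ?c0 //.
by rewrite mulr0 mul0r.
Qed.

Lemma m2_eq0 (R : realType) (L : lattice_data R) (hgrid : grid_adapted L) :
  cos (beta L) = 0 -> m2 L = 0%N.
Proof.
move=> c0; apply/eqP; rewrite -(pnatr_eq0 R) (m2_ge0E hgrid) ?c0 //.
by rewrite mulr0 mul0r.
Qed.

(** Since [l3 L] is positive, so is the discriminant under its square root; it
    follows that cos gamma cos beta - cos alpha is smaller than 1, hence the
    argument of the ceiling lies in ]-1, 1[ and has the sign of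
    cos gamma cos beta. *)
Lemma rho4E (R : realType) (L : lattice_data R) (hL : lattice_axioms L) :
    cos (alpha L) - cos (beta L) * cos (gamma L) < 0 ->
  rho4 L = if 0 < cos (gamma L) * cos (beta L) then 1 else 0.
Proof.
rewrite [cos (beta L) * _]mulrC.
set p := cos (gamma L) * cos (beta L) => D0.
have disc : 0 < 1 - cos (gamma L) ^+ 2 - cos (beta L) ^+ 2 - cos (alpha L) ^+ 2
             + 2 * cos (gamma L) * cos (beta L) * cos (alpha L).
  rewrite ltNge; apply/negP => d0; have := l3_gt0 hL.
  by rewrite /l3 ler0_sqrtr // mul0r mulr0 ltxx.
have sqr_cos (t : R) : cos t ^+ 2 <= 1.
  by rewrite -subr_ge0 -sin2cos2 sqr_ge0.
have p1 : `|p| <= 1 by rewrite normrM mulr_ile1 // cos_max.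
have D1 : (p - cos (alpha L)) ^+ 2 < 1.
  have discE : 1 - (p - cos (alpha L)) ^+ 2 =
    (1 - cos (gamma L) ^+ 2 - cos (beta L) ^+ 2 - cos (alpha L) ^+ 2
             + 2 * cos (gamma L) * cos (beta L) * cos (alpha L))
    + cos (gamma L) ^+ 2 * (1 - cos (beta L) ^+ 2) + cos (beta L) ^+ 2.
    by rewrite /p; ring.
  rewrite -subr_gt0 discE -addrA ltr_wpDr // addr_ge0 ?sqr_ge0 //.
  by rewrite mulr_ge0 ?sqr_ge0 // subr_ge0.
have D01 : p - cos (alpha L) < 1 by nra.
rewrite /rho4 -/p ceil_Ioc.
  by rewrite pmulr_lgt0 // -oppr_lt0 opprB.
move: p1; rewrite ler_norml => /andP[? ?].
by apply/andP; split; nra.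
Qed.

(** Both powers of the phase of [a1] which [J3] may carry amount to
    [rho1 L + rho2 L]; in the second one the term 1 is the phase of [a1] by
    which the shift by [m1 + m2 - n1] differs from the one by [m1 + m2].  Zero
    cosines are settled by [m1 = 0] or [m2 = 0], which excludes
    [m1 + m2 > n1].  When both cosines are negative, [psi2] must be 1, which
    fails only for [m1 = m2 = n1]; this is excluded by [m1 < n1]. *)
Lemma phase_balance (R : realType) (L : lattice_data R)
    (hL : lattice_axioms L) (hgrid : grid_adapted L) :
    cos (alpha L) - cos (beta L) * cos (gamma L) < 0 ->
  if (m1 L + m2 L <= n1 L)%N
  then rho1 L * rho4 L + psi2 L = rho1 L + rho2 L
  else - (rho5 L * rho4 L - psi2 L) + 1 = rho1 L + rho2 L.
Proof.
move=> D0; have m2n1 := m2_le hgrid; have n10 := n1_gt0 hL.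
have m1n1 := m1_le hgrid.
rewrite /psi2 (rho4E hL) // /rho1 /rho2 /rho5.
rewrite !ceil_angle ?(gamma_range hL) ?(beta_range hL) //.
rewrite ceil_Ioc ?cos_le1 ?cos_gtN1 ?(beta_range hL) //.
have [cg|cg|cg] := ltgtP (cos (gamma L)) 0; last first.
- have := m1_eq0 hgrid cg; rewrite cg (mul0r (cos _)) ltxx.
  by have [cb|cb|/(m2_eq0 hgrid) cb] := ltgtP (cos (beta L)) 0;
    do 2 case: ifP; lia.
- rewrite pmulr_rgt0 //.
  by have [cb|cb|/(m2_eq0 hgrid) cb] := ltgtP (cos (beta L)) 0;
    do 2 case: ifP; lia.
- have := m1_lt_n1 hL hgrid cg; rewrite nmulr_rgt0 //.
  by have [cb|cb|/(m2_eq0 hgrid) cb] := ltgtP (cos (beta L)) 0;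
    do 2 case: ifP; lia.
Qed.

(** * Eigenvectors of the difference matrices *)

Lemma dotDr (R : realType) (k u v : 'cV[R]_3) :
  dot k (u + v) = dot k u + dot k v.
Proof.
by rewrite /dot -big_split; apply: eq_bigr => t _; rewrite mxE mulrDr.
Qed.

Lemma dotZr (R : realType) (k : 'cV[R]_3) (a : R) v :
  dot k (a *: v) = a * dot k v.
Proof.
by rewrite /dot mulr_sumr; apply: eq_bigr => t _; rewrite mxE mulrCA.
Qed.

Lemma dotNr (R : realType) (k v : 'cV[R]_3) : dot k (- v) = - dot k v.
Proof. by rewrite -scaleN1r dotZr mulN1r. Qed.

(** The twist of the wrapped part is the phase by which [w ^+ t] fails to be
    [n1]-periodic in [t]. *)
Lemma shift_mx_geom (R : realType) (L : lattice_data R) (m : nat) (w : R[i]) :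
    (m <= n1 L)%N -> w != 0 -> w ^+ n1 L = phase (ka1 L) ->
  shift_mx L m *m geom (n1 L) w = w ^- m *: geom (n1 L) w.
Proof.
move=> le_m w0 wn.
apply: (antidiag_mx_col (f := fun t => w ^+ t)); first exact: subnKC.
  rewrite geom_shift -scalemxAl mul1mx scalerA; congr (_ *: _).
  rewrite -/(phase _) phaseN -wn.
  by rewrite -[in w ^- n1 L](subnK le_m) exprD invfM mulrAC mulVf
    ?mul1r ?expf_neq0.
rewrite mul1mx geom_shift scalerA mulVf ?scale1r //.
by rewrite expf_neq0.
Qed.

(** The last hypothesis makes the two blocks act by the same scalar: a vector
    that wraps around is multiplied by [u ^+ n2], by the scalar [sJ] of [J1] and
    by the opposite phase of [a2], and otherwise by [phase c * sS]. *)
Lemma J3_block_geom (R : realType) (L : lattice_data R) (c : R)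
    (S : 'M[R[i]]_(n1 L)) (u w sJ sS : R[i]) :
    (0 < n1 L)%N -> (m3 L <= n2 L)%N -> u != 0 ->
    J1 L *m geom (n1 L) w = sJ *: geom (n1 L) w ->
    S *m geom (n1 L) w = sS *: geom (n1 L) w ->
    u ^+ n2 L * sJ = phase (ka2 L) * (phase c * sS) ->
  J3_block c S *m (geom (n2 L) u *t geom (n1 L) w)
  = (phase ((rho3 L)%:~R * ka2 L) * (phase c * sS * u ^- m3 L))
      *: (geom (n2 L) u *t geom (n1 L) w).
Proof.
move=> n10 le_m3 u0 Jx Sx uE.
rewrite /J3_block -scalemxAl -[RHS]scalerA; congr (_ *: _); rewrite tens_geom.
apply: (antidiag_mx_col
  (f := fun r => u ^+ (r %/ n1 L) * w ^+ (r %% n1 L))).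
- by rewrite -mulnDl subnKC.
- rewrite tens_geom_shift // -tens_geom -scalemxAr -scalemxAl tensmx_mul_col.
  rewrite mul1mx Jx tensmxZr !scalerA; congr (_ *: _).
  rewrite -/(phase _) phaseN.
  have -> : phase c * sS = u ^+ n2 L * sJ / phase (ka2 L).
    by rewrite uE [RHS]mulrAC divff ?mul1r ?phase_neq0.
  rewrite -[in RHS](subnK le_m3) exprD.
  by field; rewrite phase_neq0 expf_neq0.
- rewrite tens_geom_shift // -tens_geom -scalemxAl tensmx_mul_col.
  rewrite mul1mx Sx tensmxZr !scalerA; congr (_ *: _).
  by rewrite divfK ?expf_neq0.
Qed.

(** The eigenvalue [lam] of [J3] enters only through the boundary condition
    [zeta ^+ n3 = phase (ka3 L) * lam]. *)
Lemma K3_eigen (R : realType) (L : lattice_data R) (zeta lam : R[i])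
    (v : 'cV[R[i]]_(n2 L * n1 L)) :
    J3 L *m v = lam *: v -> zeta ^+ n3 L = phase (ka3 L) * lam ->
  K3 L *m (geom (n3 L) zeta *t v : 'cV_(n3 L * (n2 L * n1 L)))
  = ((delta_z L)^-1%:C * (zeta - 1)) *: (geom (n3 L) zeta *t v).
Proof.
move=> Jv zE; rewrite /K3 -scalemxAl -[RHS]scalerA; congr (_ *: _).
rewrite (blocks_mx_mul_tens (b := fun s t : 'I_(n3 L) =>
  (if t == s then - 1 else 0) + (if t == s.+1 :> nat then 1 else 0)
  + (if (s.+1 == n3 L) && (t == 0 :> nat) then zeta ^+ n3 L else 0))).
  apply/matrixP => r o; rewrite !mxE mulrA; congr (_ * _).
  rewrite -twisted_difference_geom; apply: eq_bigr => t _.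
  by rewrite !mxE.
move=> s t; rewrite !mulmxDl !scalerDl; congr (_ + _ + _); case: ifP => _;
  rewrite ?mul0mx ?scale0r ?mulNmx ?mul1mx ?scaleNr ?scale1r //.
by rewrite -scalemxAl Jv scalerA -zE.
Qed.

(** The eigenvalue is the scalar of [J3_block_geom] as a single phase, whose
    argument matters only up to integers; both formulas for [J3] give the same
    one by [phase_balance]. *)
Lemma J3_geom (R : realType) (L : lattice_data R)
    (hL : lattice_axioms L) (hgrid : grid_adapted L)
    (hneg : cos (alpha L) - cos (beta L) * cos (gamma L) < 0) (i j : nat) :
  J3 L *m (yvec L i j *t xvec L i : 'cV_(n2 L * n1 L)) =
  phase ((rho3 L)%:~R * ka2 L + (rho1 L + rho2 L)%:~R * ka1 L
         - (m1 L + m2 L)%:R / (n1 L)%:R * (i%:R + ka1 L)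
         - (m3 L)%:R / (n2 L)%:R
           * (j%:R - (m1 L)%:R / (n1 L)%:R * i%:R + dot (kv L) (hat_a2 L)))
    *: (yvec L i j *t xvec L i).
Proof.
have n10 := n1_gt0 hL; have n20 := n2_gt0 hL.
have N1 : (n1 L)%:R != 0 :> R by rewrite pnatr_eq0 -lt0n.
have N2 : (n2 L)%:R != 0 :> R by rewrite pnatr_eq0 -lt0n.
have le_m1 := m1_le hgrid; have le_m2 := m2_le hgrid; have le_m3 := m3_le hgrid.
have bal := phase_balance hL hgrid hneg.
rewrite /yvec /xvec !power_vecE /theta_i /theta_ij !cexp_i2pi_div.
set tx := (_ + ka1 L) / _; set ty := (_ + dot _ _) / _.
have x0 := phase_neq0 tx; have y0 := phase_neq0 ty.
have xn : phase tx ^+ n1 L = phase (ka1 L) by rewrite phase_fracX // phase_natD.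
have Jx : J1 L *m geom (n1 L) (phase tx)
    = phase ((rho2 L)%:~R * ka1 L - (m2 L)%:R * tx) *: geom (n1 L) (phase tx).
  rewrite /J1 -scalemxAl shift_mx_geom // scalerA phaseX -phaseN.
  by rewrite -/(phase _) -phaseD.
have hat2E : dot (kv L) (hat_a2 L)
    = ka2 L - (m1 L)%:R / (n1 L)%:R * ka1 L + (rho1 L)%:~R * ka1 L.
  by rewrite /hat_a2 !dotDr dotNr !dotZr.
rewrite /J3; case: ifP bal => le_m12 bal.
  have Sx := shift_mx_geom le_m12 x0 xn.
  rewrite (J3_block_geom n10 le_m3 y0 Jx Sx).
    rewrite !phaseX -!phaseN -!phaseD bal; congr (phase _ *: _).
    by rewrite /tx /ty; field; apply/andP.
  rewrite phase_fracX // !phaseX -phaseN -!phaseD bal hat2E.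
  (* The eigenvalue equation for u only holds up to j full turns. *)
  rewrite -[RHS](phase_natD j); congr phase.
  by rewrite /tx rmorphD natrD; field.
have le_shift : (m1 L + m2 L - n1 L <= n1 L)%N.
  by rewrite leq_subLR leq_add.
have Sx := shift_mx_geom le_shift x0 xn.
have rho_c : rho5 L * rho4 L - psi2 L = 1 - (rho1 L + rho2 L) by lia.
have shiftE : (m1 L + m2 L - n1 L)%:R = (m1 L + m2 L)%:R - (n1 L)%:R :> R.
  by rewrite natrB // ltnW // ltnNge le_m12.
rewrite (J3_block_geom n10 le_m3 y0 Jx Sx).
  (* w^n1 is the phase of i + k.a1: removing n1 from the shift adds i turns. *)
  rewrite -[in RHS](phase_natD i).
  rewrite !phaseX -!phaseN -!phaseD rho_c shiftE; congr (phase _ *: _).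
  by rewrite /tx /ty rmorphB rmorph1; field; apply/andP.
rewrite phase_fracX // !phaseX -phaseN -!phaseD hat2E rho_c shiftE.
rewrite -[LHS](phase_natD i) -[RHS](phase_natD j); congr phase.
by rewrite /tx rmorphB rmorph1 rmorphD natrD; field.
Qed.

Lemma K3_eigvecE (R : realType) (L : lattice_data R) (i j k : nat) :
  K3_eigvec L i j k
  = geom (n3 L) (cexp (theta_ijk L i j k))
      *t (geom (n2 L) (cexp (theta_ij L i j))
            *t geom (n1 L) (cexp (theta_i L i))).
Proof. by rewrite /K3_eigvec /zvec /yvec /xvec !power_vecE. Qed.

(** The vector [hat_a3 L] is chosen such that the boundary condition of
    [K3_eigen] holds up to [k] full turns. *)
Lemma K3_eigpair (R : realType) (L : lattice_data R)
    (hL : lattice_axioms L) (hgrid : grid_adapted L)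
    (hneg : cos (alpha L) - cos (beta L) * cos (gamma L) < 0)
    (i j k : nat) :
  K3 L *m K3_eigvec L i j k = K3_eigval L i j k *: K3_eigvec L i j k.
Proof.
have N1 : (n1 L)%:R != 0 :> R by rewrite pnatr_eq0 -lt0n (n1_gt0 hL).
have N2 : (n2 L)%:R != 0 :> R by rewrite pnatr_eq0 -lt0n (n2_gt0 hL).
rewrite /K3_eigvec /zvec power_vecE.
apply: (K3_eigen (J3_geom hL hgrid hneg i j)).
rewrite /theta_ijk cexp_i2pi_div phase_fracX ?(n3_gt0 hL) // -phaseD.
rewrite -[RHS](phase_natD k); congr phase.
rewrite /hat_a2 /hat_a3 !(dotDr, dotNr, dotZr) rmorphD natrD.
rewrite -/(ka1 L) -/(ka2 L) -/(ka3 L).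
by field; apply/andP.
Qed.

Lemma K3_eigvec_free (R : realType) (L : lattice_data R) :
  free [seq K3_eigvec L t.1.1.+1 t.1.2.+1 t.2.+1
         | t : 'I_(n1 L) * 'I_(n2 L) * 'I_(n3 L)].
Proof.
rewrite (eq_image (fun=> erefl) (fun t => K3_eigvecE L _ _ _)).
apply: (nested_geom_free
  (w := fun i : 'I_(n1 L) => cexp (theta_i L i.+1))
  (u := fun i (j : 'I_(n2 L)) => cexp (theta_ij L i.+1 j.+1))
  (z := fun i j (k : 'I_(n3 L)) => cexp (theta_ijk L i.+1 j.+1 k.+1))).
- move=> i i'; rewrite /theta_i !cexp_i2pi_div; exact: phase_frac_inj.
- move=> i j j'; rewrite /theta_ij !cexp_i2pi_div -!addrA.
  exact: phase_frac_inj.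
- move=> i j k k'; rewrite /theta_ijk !cexp_i2pi_div -!addrA.
  exact: phase_frac_inj.
Qed.

Lemma K3_char_poly (R : realType) (L : lattice_data R)
    (hL : lattice_axioms L) (hgrid : grid_adapted L)
    (hneg : cos (alpha L) - cos (beta L) * cos (gamma L) < 0) :
  char_poly (K3 L) =
    \prod_(i < n1 L) \prod_(j < n2 L) \prod_(k < n3 L)
      ('X - (K3_eigval L i.+1 j.+1 k.+1)%:P).
Proof.
rewrite -(big_triple _ (fun t : 'I_(n1 L) * 'I_(n2 L) * 'I_(n3 L) =>
  'X - (K3_eigval L t.1.1.+1 t.1.2.+1 t.2.+1)%:P)).
apply: char_poly_eigenbasis (K3_eigvec_free L) => [|t]; last exact: K3_eigpair.
by rewrite !card_prod !card_ord mulnC (mulnC (n1 L)).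
Qed.

(* The indices i, j, k of the paper start at 1, hence the successors. *)
Theorem theorem4p4 (R : realType) (L : lattice_data R)
    (hL : lattice_axioms L) (hgrid : grid_adapted L)
    (hneg : cos (alpha L) - cos (beta L) * cos (gamma L) < 0) :
  [/\ (forall (i : 'I_(n1 L)) (j : 'I_(n2 L)) (k : 'I_(n3 L)),
         K3_eigvec L i.+1 j.+1 k.+1 != 0 /\
         K3 L *m K3_eigvec L i.+1 j.+1 k.+1
           = K3_eigval L i.+1 j.+1 k.+1 *: K3_eigvec L i.+1 j.+1 k.+1),
      char_poly (K3 L) =
        \prod_(i < n1 L) \prod_(j < n2 L) \prod_(k < n3 L)
          ('X - (K3_eigval L i.+1 j.+1 k.+1)%:P)
    & free [seq K3_eigvec L t.1.1.+1 t.1.2.+1 t.2.+1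
             | t : 'I_(n1 L) * 'I_(n2 L) * 'I_(n3 L)]].
Proof.
have vec_free := K3_eigvec_free L.
split=> [i j k||]; [split|exact: K3_char_poly|exact: vec_free].
  apply: (free_not0 vec_free); apply/imageP.
  by exists (i, j, k).
exact: K3_eigpair.
Qed.
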